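(* Let $R=\bigoplus_{i\ge0}R_i$ be a graded domain of Krull dimension $d\ge2$ with $\dim(R_0)\ge1$. Then for every $v\in\mathrm{Um}_{d+1}(R,R_+)$ there exists $\alpha\in\mathrm{GL}_{d+1}(R,R_+)$ with $v\alpha=e_1$. Consequently $\mathrm{Um}_{d+1}(R)=e_1\mathrm{H}_{d+1}(R)$, i.e. every unimodular row of length $d+1$ is of the form $e_1\alpha$ with $\alpha\in \mathrm H_{d+1}(R)$.
   Context: Rings are commutative Noetherian with $1\ne0$ of finite Krull dimension; graded means non-trivially $\mathbb N$-graded, $R_+=\bigoplus_{i\ge1}R_i$. $\mathrm{Um}_n(B)$: unimodular rows of length $n$; $\mathrm{Um}_n(B,I)=\{v\in\mathrm{Um}_n(B):v\equiv e_1\bmod I\}$; $\mathrm{GL}_n(B,I)=\{\alpha\in\mathrm{GL}_n(B):\alpha\equiv\mathrm{Id}\bmod I\}$; $e_1=(1,0,\dots,0)$. $\mathrm H_n(B)=\{\alpha\in\mathrm{GL}_n(B):\exists\,\theta(T)\in\mathrm{GL}_n(B[T])\text{ with }\theta(0)=\mathrm{Id},\ \theta(1)=\alpha\}$. For a subgroup $G\subset\mathrm{GL}_n(B)$, $e_1G=\{e_1g:g\in G\}$. *)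

(* Defs.v *)
From HB Require Import structures.
From mathcomp Require Import all_boot all_order all_algebra.
Set Implicit Arguments. Unset Strict Implicit. Unset Printing Implicit Defensive.
Import Order.TTheory GRing.Theory Num.Theory.
Local Open Scope ring_scope.

Section Defs.
Variable R : comUnitRingType.

(* Ideals of a subring S of R (S given as a predicate on R);
   taking S = fun _ => True gives ideals of R itself. *)
Definition sub_ideal (S : R -> Prop) (I : R -> Prop) : Prop :=
  [/\ forall x, I x -> S x,
      I 0,
      forall x y, I x -> I y -> I (x - y) &
      forall s x, S s -> I x -> I (s * x)].

Definition sub_prime (S : R -> Prop) (P : R -> Prop) : Prop :=
  [/\ sub_ideal S P, ~ P 1 &
      forall a b, S a -> S b -> P (a * b) -> P a \/ P b].

Definition strict_incl (I J : R -> Prop) : Prop :=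
  (forall x, I x -> J x) /\ exists x, J x /\ ~ I x.

Definition prime_chain (S : R -> Prop) (n : nat) (c : nat -> R -> Prop) : Prop :=
  (forall i, (i <= n)%N -> sub_prime S (c i)) /\
  (forall i, (i < n)%N -> strict_incl (c i) (c i.+1)).

Definition krull_dim (S : R -> Prop) (d : nat) : Prop :=
  (exists c, prime_chain S d c) /\ ~ (exists c, prime_chain S d.+1 c).

Definition whole : R -> Prop := fun _ => True.

Definition noetherian : Prop :=
  forall I : nat -> R -> Prop,
    (forall n, sub_ideal whole (I n)) ->
    (forall n x, I n x -> I n.+1 x) ->
    exists N, forall m, (N <= m)%N -> forall x, I m x -> I N x.

Definition graded (Rg : nat -> R -> Prop) : Prop :=
  (forall i, Rg i 0) /\
  (forall i x y, Rg i x -> Rg i y -> Rg i (x - y)) /\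
  Rg 0%N 1 /\
  (forall i j x y, Rg i x -> Rg j y -> Rg (i + j)%N (x * y)) /\
  (forall x, exists (n : nat) (f : nat -> R),
      (forall i, Rg i (f i)) /\ x = \sum_(i < n) f i) /\
  (forall (n : nat) (f : nat -> R), (forall i, Rg i (f i)) ->
      \sum_(i < n) f i = 0 -> forall i, (i < n)%N -> f i = 0) /\
  (exists i x, (0 < i)%N /\ Rg i x /\ x <> 0).

Definition Rplus (Rg : nat -> R -> Prop) (x : R) : Prop :=
  exists (n : nat) (f : nat -> R),
    (forall i, Rg i (f i)) /\ x = \sum_(1 <= i < n) f i.

Definition e1 (n : nat) : 'rV[R]_n.+1 := delta_mx 0 ord0.

Definition unimodular (n : nat) (v : 'rV[R]_n) : Prop :=
  exists w : 'cV[R]_n, v *m w = 1%:M.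

Definition Um_rel (n : nat) (I : R -> Prop) (v : 'rV[R]_n.+1) : Prop :=
  unimodular v /\ forall j, I (v 0 j - e1 n 0 j).

Definition GL_rel (n : nat) (I : R -> Prop) (a : 'M[R]_n) : Prop :=
  a \in unitmx /\ forall i j, I (a i j - (1%:M : 'M[R]_n) i j).
End Defs.

Definition Hgrp (R : idomainType) (n : nat) (a : 'M[R]_n) : Prop :=
  exists th : 'M[{poly R}]_n,
    [/\ th \in unitmx,
        map_mx (fun p => p.[0]) th = 1%:M &
        map_mx (fun p => p.[1]) th = a].

(* Main.v *)
Require Import Defs.
From Stdlib Require Import Classical ClassicalEpsilon.
From HB Require Import structures.
From mathcomp Require Import all_boot all_order all_algebra.
From mathcomp Require Import ring zify.
Import GRing.Theory.
Local Open Scope ring_scope.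
Set Implicit Arguments.
Unset Strict Implicit.
Unset Printing Implicit Defensive.

(** Let [s] be a nonzero nonunit of [R_0].  The primes of [R] avoiding the monoid
    [s^N (1 + s R_0)] form chains of length at most [d - 1]: if [P] is the top of such a
    chain of length [d], its largest homogeneous subideal [P*] has height at least
    [d - 1] (and [d] if [P = P*]), while [P*] lies under [(P*, R_+)], which lies strictly
    under a prime containing [s].  So the two pieces [R / s] and [R_{s(1 + s R_0)}] have
    dimension less than [d], and applying the stable range theorem to one piece after the
    other turns a unimodular row [(a, b)] of length [d + 1] into some [(a, b')] such that
    the ideal of [b'] contains an element [t = 1 + s r] with [r] in [R_0].  Hence the row
    is elementarily equivalent to [e_1] over [R_t].  Repeating this with [t] in place of
    [s] gives [t' = 1 + t r'], comaximal with [t], and Quillen patching along the homotopy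
    [x_i |-> x_i T^i] connects the row to its degree-zero part [e_1].  Denominators are
    kept explicit throughout, so no localisation is formed. *)

(** * Primes, chains and the stable range *)

Notation ideal I := (sub_ideal (@whole _) I).
Notation prime_ideal P := (sub_prime (@whole _) P).

Definition avoids (R : comUnitRingType) (I T : R -> Prop) : Prop :=
  forall t, T t -> ~ I t.

Definition monoid (R : comUnitRingType) (T : R -> Prop) : Prop :=
  T 1 /\ forall t u, T t -> T u -> T (t * u).

Lemma least_nat (Q : nat -> Prop) n :
  Q n -> exists2 m, Q m & forall k, (k < m)%N -> ~ Q k.
Proof.
elim/ltn_ind: n => n IHn Qn.
have [[k [ltkn Qk]]|noQ] := classic (exists k, (k < n)%N /\ Q k).
  exact: IHn ltkn Qk.
by exists n => // k ltkn Qk; apply: noQ; exists k.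
Qed.

Section Ideals.
Variables (R : comUnitRingType).
Implicit Types (I J P T : R -> Prop).

Lemma ideal_mem0 I : ideal I -> I 0. Proof. by case. Qed.

Lemma ideal_memB I x y : ideal I -> I x -> I y -> I (x - y).
Proof. by case=> _ _ IB _; apply: IB. Qed.

Lemma ideal_memMl I a x : ideal I -> I x -> I (a * x).
Proof. by case=> _ _ _ IM; apply: IM. Qed.

Lemma ideal_memMr I a x : ideal I -> I x -> I (x * a).
Proof. by rewrite mulrC; apply: ideal_memMl. Qed.

Lemma ideal_memN I x : ideal I -> I x -> I (- x).
Proof. by move=> idI Ix; rewrite -sub0r; apply: ideal_memB => //; apply: ideal_mem0. Qed.

Lemma ideal_memD I x y : ideal I -> I x -> I y -> I (x + y).
Proof. by move=> idI Ix Iy; rewrite -[y]opprK; apply: ideal_memB => //; apply: ideal_memN. Qed.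

Lemma ideal_subr I x y : ideal I -> I x -> I (x - y) -> I y.
Proof. by move=> idI Ix Ixy; rewrite -(subKr x y); apply: ideal_memB. Qed.

Lemma ideal_subl I x y : ideal I -> I y -> I (x - y) -> I x.
Proof. by move=> idI Iy Ixy; rewrite -(subrK y x); apply: ideal_memD. Qed.

Lemma ideal_sum I (K : Type) (r : seq K) (p : pred K) (F : K -> R) :
  ideal I -> (forall i, p i -> I (F i)) -> I (\sum_(i <- r | p i) F i).
Proof.
by move=> idI IF; elim/big_ind: _ => //; [apply: ideal_mem0|move=> *; apply: ideal_memD].
Qed.

Lemma prime_ideal_ideal P : prime_ideal P -> ideal P. Proof. by case. Qed.

Lemma prime_idealM P a b : prime_ideal P -> P (a * b) -> P a \/ P b.
Proof. by case=> _ _ PM; apply: PM. Qed.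

Lemma prime_idealX P a n : prime_ideal P -> P (a ^+ n) -> P a.
Proof.
move=> prP; elim: n => [|n IHn]; first by case: prP.
by rewrite exprS => /(prime_idealM prP) [|/IHn].
Qed.

(** * Maximal ideals relative to a monoid, and primes avoiding it *)

Definition add_principal I a : R -> Prop := fun x => exists r, I (x - r * a).

Lemma add_principal_ideal I a : ideal I -> ideal (add_principal I a).
Proof.
move=> idI; split=> //.
- by exists 0; rewrite mul0r subr0; apply: ideal_mem0.
- move=> x y [r Ixr] [s Iys]; exists (r - s).
  rewrite (_ : _ - _ = (x - r * a) - (y - s * a)); last by ring.
  exact: ideal_memB.
- move=> s x _ [r Ixr]; exists (s * r).
  rewrite (_ : _ - _ = s * (x - r * a)); last by ring.
  exact: ideal_memMl.
Qed.

Lemma add_principal_sub I a x : I x -> add_principal I a x.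
Proof. by exists 0; rewrite mul0r subr0. Qed.

Lemma add_principal_gen I a : ideal I -> add_principal I a a.
Proof. by move=> idI; exists 1; rewrite mul1r subrr; apply: ideal_mem0. Qed.

(** Otherwise dependent choice builds a strictly increasing sequence of ideals above [I], against
    the ascending chain condition. *)
Lemma noetherian_maximal (Q : (R -> Prop) -> Prop) I :
    @noetherian R -> (forall J, Q J -> ideal J) -> Q I ->
  exists2 J, Q J /\ (forall x, I x -> J x) &
             forall K, Q K -> (forall x, J x -> K x) -> forall x, K x -> J x.
Proof.
move=> noethR Qideal QI; apply: NNPP => noMax.
pose X := {J | Q J /\ forall x, I x -> J x}.
have step (J : X) : {K : X | strict_incl (sval J) (sval K)}.
  apply: constructive_indefinite_description.
  case: J => J [QJ IJ] /=; apply: NNPP => noK; apply: noMax; exists J => //.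
  move=> K QK JK x Kx; apply: NNPP => nJx; apply: noK.
  have QIK : Q K /\ forall x, I x -> K x by split=> // y /IJ /JK.
  by exists (exist _ K QIK); split=> //=; exists x.
pose F := fix F n : X := if n is n'.+1 then sval (step (F n'))
                         else exist _ I (conj QI (fun _ => id)).
have F_strict n : strict_incl (sval (F n)) (sval (F n.+1)) by exact: (svalP (step _)).
have [||N stable] := noethR (fun n => sval (F n)).
- by move=> n; apply: Qideal; case: (F n) => J [].
- by move=> n x; apply: (F_strict n).1.
have [_ [x [FNx nFNx]]] := F_strict N.
exact/nFNx/(stable N.+1).
Qed.

(** An ideal [P] maximal among those avoiding [T] is prime: if [a] and [b] lie outside [P], then
    [P + R a] and [P + R b] contain some [t] and [u] of [T], and [a b] in [P] would force [t u] into
    [P]. *)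
Lemma exists_prime_avoiding I T :
    @noetherian R -> ideal I -> monoid T -> avoids I T ->
  exists P, [/\ prime_ideal P, forall x, I x -> P x & avoids P T].
Proof.
move=> noethR idI [T1 TM] avI.
pose Q J := ideal J /\ avoids J T.
have [|P [[idP avP] IP] maxP] := @noetherian_maximal Q I noethR _ (conj idI avI).
  by move=> J [].
have meet a : ~ P a -> exists2 t, T t & add_principal P a t.
  move=> nPa; apply: NNPP => noT; apply: nPa.
  apply: (maxP (add_principal P a)); last exact: add_principal_gen.
    split; first exact: add_principal_ideal.
    by move=> t Tt Pat; apply: noT; exists t.
  exact: add_principal_sub.
exists P; split=> //; split=> // [|a b _ _ Pab]; first exact: avP T1.
apply: NNPP => /not_or_and [/meet [t Tt [r Pt]] /meet [u Tu [s Pu]]].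
apply: (avP (t * u)); first exact: TM.
rewrite (_ : t * u = (t - r * a) * u + (r * a) * (u - s * b) + r * s * (a * b)); last by ring.
apply: ideal_memD => //; last exact: ideal_memMl.
by apply: ideal_memD => //; [apply: ideal_memMr|apply: ideal_memMl].
Qed.

(** Chains grow at their top prime, which suits both prolonging a chain and removing its last
    step. *)
Inductive height_ge : nat -> (R -> Prop) -> Prop :=
| height_ge0 P : prime_ideal P -> height_ge 0 P
| height_geS n P Q :
    height_ge n P -> prime_ideal Q -> strict_incl P Q -> height_ge n.+1 Q.

Lemma height_ge_prime n P : height_ge n P -> prime_ideal P. Proof. by case. Qed.

Lemma height_ge_chain n P :
  height_ge n P -> exists2 c, prime_chain (@whole R) n c & c n = P.
Proof.
elim=> [{}P prP|{}n {}P Q _ [c [c_pr c_lt] <-] prQ ltPQ].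
  by exists (fun=> P); split.
exists (fun i => if (i <= n)%N then c i else Q); last by rewrite ltnn.
split=> i; last first.
  rewrite ltnS => lein; rewrite lein; case: (ltngtP i n) lein => // [ltin|->] _; first exact: c_lt.
  exact: ltPQ.
by case: (leqP i n) => [lein|_] _; [apply: c_pr|apply: prQ].
Qed.

(* The iterated boundary monoids [b_0^N (b_1^N (... (S + R b_(n-1)) ...) + R b_0)] of
   Coquand and Lombardi: they meet 0 as soon as no chain of [n + 1] primes avoids [S]. *)
Fixpoint boundary_monoid (S : R -> Prop) n (b : nat -> R) : R -> Prop :=
  if n is n'.+1 then
    fun z => exists k t x, boundary_monoid S n' (b \o succn) t /\
                           z = b 0 ^+ k * (t + x * b 0)
  else S.

Lemma boundary_monoidP S n b : monoid S -> monoid (boundary_monoid S n b).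
Proof.
move=> monS; elim: n b => //= n IHn b; have [T1 TM] := IHn (b \o succn).
split; first by exists 0, 1, 0; split=> //; ring.
move=> _ _ [k [t [x [Tt ->]]]] [l [u [y [Tu ->]]]].
exists (k + l)%N, (t * u), (x * u + t * y + x * y * b 0); split; first exact: TM.
by rewrite exprD; ring.
Qed.

(** If [P] avoids the monoid of [b], then [P + R b_0] avoids the next inner monoid, and so does some
    prime above it. The inclusion is strict because [b_0] itself lies in the outer monoid. Each
    level thus lengthens the chain by one. *)
Lemma boundary_monoid_chain S n b m P :
    @noetherian R -> monoid S -> height_ge m P ->
    avoids P (boundary_monoid S n b) ->
  exists2 Q, height_ge (m + n) Q & avoids Q S.
Proof.
move=> noethR monS; elim: n b m P => [|n IHn] b m P htP avP.
  by exists P; rewrite ?addn0.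
have idP := prime_ideal_ideal (height_ge_prime htP).
have monT := boundary_monoidP n (b \o succn) monS.
have [||Q [prQ PQ avQ]] := @exists_prime_avoiding (add_principal P (b 0)) _ noethR _ monT.
- exact: add_principal_ideal.
- move=> t Tt [r Pt]; apply: avP Pt; exists 0, t, (- r); split=> //; ring.
rewrite addnS -addSn; apply: IHn avQ; apply: height_geS htP prQ _; split.
  by move=> x Px; apply/PQ/add_principal_sub.
exists (b 0); split; first exact/PQ/add_principal_gen.
apply: avP; exists 1%N, 1, 0; split; [by case: monT|ring].
Qed.

(** For [z = b_0^k (t + x b_0)] the choice is [y_0 = t + x b_0]. If [P] contains [z] and
    [b_0 + a y_0], it contains both [b_0] and [a y_0]. Then either [a] is in [P], or [y_0] is, hence
    [t] is, and the recursion continues with [t]. *)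
Lemma boundary_monoid_perturb S n b a z :
    boundary_monoid S n b z ->
  exists y : nat -> R, forall P, prime_ideal P -> avoids P S -> P z ->
    (forall i, (i < n)%N -> P (b i + a * y i)) ->
  P a /\ forall i, (i < n)%N -> P (b i).
Proof.
elim: n b z => /= [|n IHn] b z.
  by move=> Sz; exists (fun=> 0) => P _ avP /(avP _ Sz).
case=> k [t [x [Tt ->]]]; have [y yP] := IHn _ _ Tt.
exists (fun i => if i is j.+1 then y j else t + x * b 0) => P prP avP Pz Pby.
have idP := prime_ideal_ideal prP.
have Pby0 : P (b 0 + a * (t + x * b 0)) by exact: (Pby 0).
have [Pb0 Pay] : P (b 0) /\ P (a * (t + x * b 0)).
  case: (prime_idealM prP Pz) => [/(prime_idealX prP) Pb0|Py].
    by split=> //; rewrite -(addKr (b 0) (a * _)) addrC; apply: ideal_memB.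
  have Pay : P (a * (t + x * b 0)) by apply: ideal_memMl.
  by split=> //; rewrite -(addrK (a * (t + x * b 0)) (b 0)); apply: ideal_memB.
have Pbs : P a -> forall i, (i < n.+1)%N -> P (b i).
  move=> Pa i lti; have := Pby i lti; set c := a * _ => Pbc.
  by rewrite -(addrK c (b i)); apply: ideal_memB => //; apply: ideal_memMr.
case: (prime_idealM prP Pay) => [Pa|Py]; first by split=> //; apply: Pbs.
suff [Pa _] : P a /\ forall i, (i < n)%N -> P (b i.+1) by split=> //; apply: Pbs.
apply: yP => //; last by move=> i lti; apply: (Pby i.+1).
by rewrite -(addrK (x * b 0) t); apply: ideal_memB => //; apply: ideal_memMl.
Qed.

(** For an ideal [I], this is the ideal generated by [I] and the entries of [b]. *)
Definition add_row n I (b : 'rV[R]_n) : R -> Prop :=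
  fun x => exists c : 'cV[R]_n, I (x - (b *m c) 0 0).

Lemma add_row_ideal n I (b : 'rV_n) : ideal I -> ideal (add_row I b).
Proof.
move=> idI; split=> //.
- by exists 0; rewrite mulmx0 mxE subr0; apply: ideal_mem0.
- move=> x y [c Ix] [e Iy]; exists (c - e).
  rewrite mulmxBr !mxE in Ix Iy *.
  rewrite (_ : _ - _ = (x - (b *m c) 0 0) - (y - (b *m e) 0 0)); last by rewrite !mxE; ring.
  by rewrite !mxE; apply: ideal_memB.
- move=> s x _ [c Ix]; exists (s *: c); rewrite -scalemxAr mxE -mulrBr; exact: ideal_memMl.
Qed.

Lemma add_row_sub n I (b : 'rV_n) x : I x -> add_row I b x.
Proof. by exists 0; rewrite mulmx0 mxE subr0. Qed.

Lemma add_row_gen n I (b : 'rV_n) j : ideal I -> add_row I b (b 0 j).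
Proof.
move=> idI; exists (delta_mx j 0); rewrite -colE mxE subrr; exact: ideal_mem0.
Qed.

(** The ideal [I] meets the boundary monoid of [b], since otherwise a prime of height at least
    [m + n] would avoid [S]. For the [y] attached to a common element, a prime avoiding [S] above
    the new ideal would contain [a] and all of [b], hence 1. *)
Theorem stable_range I S m n (a : R) (b : 'rV[R]_n) :
    @noetherian R -> ideal I -> monoid S ->
    (forall P, prime_ideal P -> (forall x, I x -> P x) -> height_ge m P) ->
    (forall Q, height_ge (m + n) Q -> exists2 t, S t & Q t) ->
    (exists r, add_row (fun x => x = 0) b (1 - a * r)) ->
  exists y : 'rV[R]_n, exists2 t, S t & add_row I (b + a *: y) t.
Proof.
move=> noethR idI monS htI htS [r [w /subr0_eq a_b_1]].
(* The row is prolonged by zeros to a sequence, the form used by boundary monoids. *)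
pose B i := oapp (b 0) 0 (insub i).
have BE (j : 'I_n) : B j = b 0 j by rewrite /B valK.
have [z Tz Iz] : exists2 z, boundary_monoid S n B z & I z.
  apply: NNPP => noz.
  have [|P [prP IP avP]] := @exists_prime_avoiding I _ noethR idI (boundary_monoidP n B monS).
    by move=> t Tt It; apply: noz; exists t.
  have [Q htQ avQ] := boundary_monoid_chain noethR monS (htI P prP IP) avP.
  by have [t St] := htS Q htQ; apply: avQ.
have [y yP] := boundary_monoid_perturb a Tz.
exists (\row_j y j); apply: NNPP => noS.
have [||P [prP IP avP]] := @exists_prime_avoiding (add_row I (b + a *: \row_j y j)) S noethR _ monS.
- exact: add_row_ideal.
- by move=> t St It; apply: noS; exists t.
have [idP nP1 _] := prP.
have [||Pa Pb] := yP P prP avP; first exact/IP/add_row_sub.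
  move=> i lti; rewrite (BE (Ordinal lti)); have := add_row_gen (b + a *: \row_j y j) (Ordinal lti) idI.
  by move/IP; rewrite !mxE.
apply: nP1; rewrite -(subrK (a * r) 1) a_b_1 mxE.
apply: ideal_memD => //; last exact: ideal_memMr.
by apply: ideal_sum => // j _; rewrite -BE; apply: ideal_memMr => //; apply: Pb.
Qed.
End Ideals.

(** * Primes of a graded ring *)

(* A grading is encoded by [x |-> \sum_i x_i T^i], whose coefficients are the homogeneous
   components of [x]; degree zero elements are those mapped to constants. *)
Definition grading_morphism (R : comUnitRingType) (phi : {rmorphism R -> {poly R}}) :=
  (forall x, (phi x).[1] = x) /\
  (forall x i, phi (phi x)`_i = (phi x)`_i *: 'X^i).

(** * From homogeneous components to a ring morphism *)

Section GradingExists.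
Variables (R : comUnitRingType) (Rg : nat -> R -> Prop).
Hypothesis gradedRg : graded Rg.

Let homog (p : {poly R}) := forall i, Rg i p`_i.

Fact graded0 i : Rg i 0. Proof. by case: gradedRg => + _; apply. Qed.
Fact gradedB i x y : Rg i x -> Rg i y -> Rg i (x - y).
Proof. by case: gradedRg => _ [+ _]; apply. Qed.
Fact gradedD i x y : Rg i x -> Rg i y -> Rg i (x + y).
Proof.
move=> Rx Ry; rewrite -[y]opprK; apply: gradedB => //.
by rewrite -sub0r; apply: gradedB => //; apply: graded0.
Qed.

Fact graded_sum i (K : Type) (r : seq K) (p : pred K) F :
  (forall j, p j -> Rg i (F j)) -> Rg i (\sum_(j <- r | p j) F j).
Proof. by move=> RF; elim/big_ind: _ => //; [apply: graded0|move=> *; apply: gradedD]. Qed.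

Lemma hornerx1 (p : {poly R}) n : (size p <= n)%N -> p.[1] = \sum_(i < n) p`_i.
Proof.
move=> lepn; rewrite (horner_coef_wide _ lepn).
by apply: eq_bigr => i _; rewrite expr1n mulr1.
Qed.

Fact homog_inj p q : homog p -> homog q -> p.[1] = q.[1] -> p = q.
Proof.
case: gradedRg => _ [_ [_ [_ [_ [uniq _]]]]] hp hq eqpq; apply/polyP => i.
have [le_i|lt_i] := leqP (maxn (size p) (size q)) i.
  by move: le_i; rewrite geq_max => /andP[? ?]; rewrite !nth_default.
apply/subr0_eq; pose f i := p`_i - q`_i; rewrite -/(f i).
apply: (uniq (maxn (size p) (size q)) f) lt_i => [j|]; first exact: gradedB.
by rewrite sumrB -!hornerx1 ?leq_maxl ?leq_maxr // eqpq subrr.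
Qed.

Fact homog_exists x : exists p, homog p /\ p.[1] = x.
Proof.
case: gradedRg => R0 [_ [_ [_ [span _]]]].
have [n [f [Rf ->]]] := span x; exists (\poly_(i < n) f i); split.
  by move=> i; rewrite coef_poly; case: ifP.
by rewrite horner_poly; apply: eq_bigr => i _; rewrite expr1n mulr1.
Qed.

(** Evaluation at 1 is a bijection onto [R] from the polynomials whose coefficient of index [i] lies
    in [Rg i]. These polynomials form a ring, so the inverse is a ring morphism. *)
Lemma graded_morphism_exists :
  exists phi : {rmorphism R -> {poly R}},
    grading_morphism phi /\
    forall i x, Rg i x <-> phi x = x *: 'X^i.
Proof.
have homogM p q : homog p -> homog q -> homog (p * q).
  case: gradedRg => _ [_ [_ [RM _]]] hp hq i; rewrite coefM; apply: graded_sum => j _.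
  by have := RM _ _ _ _ (hp j) (hq (i - j)%N); rewrite subnKC // -ltnS.
have homogZ i x : Rg i x -> homog (x *: 'X^i).
  move=> Rx j; rewrite coefZ coefXn; case: eqP => [->|_]; first by rewrite mulr1.
  by rewrite mulr0; apply: graded0.
have [f fP] : exists f : R -> {poly R}, forall x, homog (f x) /\ (f x).[1] = x.
  exists (fun x => sval (constructive_indefinite_description _ (homog_exists x))) => x.
  exact: svalP (constructive_indefinite_description _ (homog_exists x)).
have fE p x : homog p -> p.[1] = x -> f x = p.
  by move=> hp p1; have [hf f1] := fP x; apply: homog_inj; rewrite ?f1.
have fB : zmod_morphism f.
  move=> x y; have [[hx x1] [hy y1]] := (fP x, fP y); apply: fE.
    by move=> i; rewrite coefB; apply: gradedB.
  by rewrite hornerD hornerN x1 y1.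
have fM : monoid_morphism f.
  split=> [|x y]; last first.
    by have [[hx x1] [hy y1]] := (fP x, fP y); apply: fE; [exact: homogM|rewrite hornerM x1 y1].
  apply: fE; last by rewrite hornerC.
  case: gradedRg => R0 [_ [R1 _]] i; rewrite coefC; case: eqP => [->|_] //; exact: R0.
pose fA := GRing.isZmodMorphism.Build R {poly R} f fB.
pose fMM := GRing.isMonoidMorphism.Build R {poly R} f fM.
pose phi : {rmorphism R -> {poly R}} := HB.pack f fA fMM.
have fhomog i x : Rg i x -> f x = x *: 'X^i.
  by move=> Rx; apply: fE; [exact: homogZ|rewrite hornerZ hornerXn expr1n mulr1].
exists phi; split; [split=> [x|x i]|move=> i x; split].
- by have [] := fP x.
- by apply: fhomog; have [] := fP x.
- exact: fhomog.
- by move=> fx; have [/(_ i)] := fP x; rewrite [f x]fx coefZ coefXn eqxx mulr1.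
Qed.
End GradingExists.

(** * Widths modulo a prime, homogeneous cores and their heights *)

Section Grading.
Variables (R : idomainType) (phi : {rmorphism R -> {poly R}}).
Hypothesis phiP : grading_morphism phi.
Implicit Types (P Q I : R -> Prop).

Lemma phi1 x : (phi x).[1] = x. Proof. exact: phiP.1. Qed.

Lemma phi_comp x i : phi (phi x)`_i = (phi x)`_i *: 'X^i. Proof. exact: phiP.2. Qed.

Lemma sum_comp x : x = \sum_(i < size (phi x)) (phi x)`_i.
Proof. by rewrite -{1}[x]phi1 (hornerx1 (leqnn _)). Qed.

Definition order_mod I (f : {poly R}) b := ~ I f`_b /\ forall i, (i < b)%N -> I f`_i.
Definition degree_mod I (f : {poly R}) t := ~ I f`_t /\ forall i, (t < i)%N -> I f`_i.

(** In the coefficient of index [b + c], every product other than [f_b g_c] has a factor in [I], and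
    primality keeps that one outside [I]. *)
Lemma order_modM I f g b c : prime_ideal I ->
  order_mod I f b -> order_mod I g c -> order_mod I (f * g) (b + c).
Proof.
move=> prI [nfb ltb] [ngc ltc]; have idI := prime_ideal_ideal prI.
have leb (k : 'I_(b + c).+1) : k != inord b -> I (f`_k * g`_(b + c - k)).
  move=> neq_k; have [ltkb|lebk] := ltnP k b; first by apply: ideal_memMr => //; apply: ltb.
  have neq_kb : k != b :> nat.
    by apply: contraNneq neq_k => eq_kb; rewrite -val_eqE /= inordK ?eq_kb // ltnS leq_addr.
  by apply: ideal_memMl => //; apply: ltc; move/eqP: neq_kb; have := ltn_ord k; lia.
split=> [|i lti]; last first.
  rewrite coefM; apply: ideal_sum => // j _.
  have [ltjb|lebj] := ltnP j b; first by apply: ideal_memMr => //; apply: ltb.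
  by apply: ideal_memMl => //; apply: ltc; have := ltn_ord j; lia.
rewrite coefM (bigD1 (inord b)) //= inordK ?ltnS ?leq_addr // addKn => Isum.
have : I (f`_b * g`_c).
  rewrite -[_ * _](addrK (\sum_(k < (b + c).+1 | k != inord b) f`_k * g`_(b + c - k))).
  by apply: ideal_memB => //; apply: ideal_sum.
by case/(prime_idealM prI).
Qed.

Lemma degree_modM I f g b c : prime_ideal I ->
  degree_mod I f b -> degree_mod I g c -> degree_mod I (f * g) (b + c).
Proof.
move=> prI [nfb ltb] [ngc ltc]; have idI := prime_ideal_ideal prI.
have leb (k : 'I_(b + c).+1) : k != inord b -> I (f`_k * g`_(b + c - k)).
  move=> neq_k; have [ltbk|lekb] := ltnP b k; first by apply: ideal_memMr => //; apply: ltb.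
  have neq_kb : k != b :> nat.
    by apply: contraNneq neq_k => eq_kb; rewrite -val_eqE /= inordK ?eq_kb // ltnS leq_addr.
  by apply: ideal_memMl => //; apply: ltc; move/eqP: neq_kb; lia.
split=> [|i lti]; last first.
  rewrite coefM; apply: ideal_sum => // j _.
  have [ltbj|lejb] := ltnP b j; first by apply: ideal_memMr => //; apply: ltb.
  by apply: ideal_memMl => //; apply: ltc; have := ltn_ord j; lia.
rewrite coefM (bigD1 (inord b)) //= inordK ?ltnS ?leq_addr // addKn => Isum.
have : I (f`_b * g`_c).
  rewrite -[_ * _](addrK (\sum_(k < (b + c).+1 | k != inord b) f`_k * g`_(b + c - k))).
  by apply: ideal_memB => //; apply: ideal_sum.
by case/(prime_idealM prI).
Qed.

Lemma order_mod_exists I (f : {poly R}) i : ~ I f`_i -> exists b, order_mod I f b.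
Proof.
case/(@least_nat (fun i => ~ I f`_i)) => b nIb ltb.
by exists b; split=> // k /ltb /NNPP.
Qed.

Lemma degree_mod_exists I (f : {poly R}) i :
  ideal I -> ~ I f`_i -> exists t, degree_mod I f t.
Proof.
move=> idI nIi.
have lti : (i < size f)%N.
  by rewrite ltnNge; apply/negP => lefi; apply: nIi; rewrite nth_default //; apply: ideal_mem0.
(* The degree is located through its distance to the top coefficient, which is to be minimal. *)
have [|k nIk ltk] := @least_nat (fun k => ~ I f`_((size f).-1 - k)) ((size f).-1 - i)%N.
  by rewrite subKn // -ltnS prednK // (leq_ltn_trans _ lti).
exists ((size f).-1 - k)%N; split=> // j ltj.
have [lej|ltjf] := leqP (size f) j; first by rewrite nth_default //; apply: ideal_mem0.
apply: NNPP => nIj; apply: (ltk ((size f).-1 - j)%N); first lia.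
by rewrite subKn //; lia.
Qed.

(** The gap between the lowest and the highest component outside [I]. It plays the part of the
    Euclidean size in [k[t, t^-1]], where homogeneous elements are units and have width 0. *)
Definition width_mod I x w := exists b, order_mod I (phi x) b /\ degree_mod I (phi x) (b + w).

Lemma width_modM I x y u w : prime_ideal I ->
  width_mod I x u -> width_mod I y w -> width_mod I (x * y) (u + w).
Proof.
move=> prI [b [ob tb]] [c [oc tc]]; exists (b + c)%N; rewrite rmorphM addnACA.
by split; [apply: order_modM|apply: degree_modM].
Qed.

Lemma order_mod_uniq I f b c : order_mod I f b -> order_mod I f c -> b = c.
Proof.
move=> [nb ltb] [nc ltc]; case: (ltngtP b c) => // lt_bc; first by case: nb; apply: ltc.
by case: nc; apply: ltb.
Qed.

Lemma degree_mod_uniq I f b c : degree_mod I f b -> degree_mod I f c -> b = c.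
Proof.
move=> [nb ltb] [nc ltc]; case: (ltngtP b c) => // lt_bc; last by case: nb; apply: ltc.
by case: nc; apply: ltb.
Qed.

Lemma width_mod_uniq I x u w : width_mod I x u -> width_mod I x w -> u = w.
Proof.
move=> [b [ob tb]] [c [oc tc]]; have eq_bc := order_mod_uniq ob oc; subst c.
exact/(@addnI b)/(degree_mod_uniq tb tc).
Qed.

(* The largest homogeneous ideal contained in [P]. *)
Definition core P : R -> Prop := fun x => forall i, P (phi x)`_i.

Lemma core_sub P x : ideal P -> core P x -> P x.
Proof. by move=> idP cx; rewrite (sum_comp x); apply: ideal_sum. Qed.

Lemma core_comp P x i : ideal P -> P (phi x)`_i -> core P (phi x)`_i.
Proof.
move=> idP Px j; rewrite phi_comp coefZ coefXn; case: eqP => _; rewrite ?mulr1 //.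
by rewrite mulr0; apply: ideal_mem0.
Qed.

Lemma core_ideal P : ideal P -> ideal (core P).
Proof.
move=> idP; split=> //.
- by move=> i; rewrite rmorph0 coef0; apply: ideal_mem0.
- by move=> x y cx cy i; rewrite rmorphB coefB; apply: ideal_memB.
- by move=> s x _ cx i; rewrite rmorphM coefM; apply: ideal_sum => // j _; apply: ideal_memMl.
Qed.

(** Two elements outside the core have orders modulo [P]; these add up, so the product has a
    component outside [P]. *)
Lemma core_prime P : prime_ideal P -> prime_ideal (core P).
Proof.
move=> prP; have [idP nP1 _] := prP; split; first exact: core_ideal.
  by move=> /(_ 0%N); rewrite rmorph1 coef1.
move=> a b _ _ cab; apply: NNPP => /not_or_and [/not_all_ex_not [i na] /not_all_ex_not [j nb]].
have [[k oa] [l ob]] := (order_mod_exists na, order_mod_exists nb).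
by have [] := order_modM prP oa ob; rewrite -rmorphM.
Qed.

Lemma width_mod_exists P x : ideal P -> ~ core P x -> exists w, width_mod (core P) x w.
Proof.
move=> idP /not_all_ex_not [i nPi].
have nci : ~ core P (phi x)`_i by move/(_ i); rewrite phi_comp coefZ coefXn eqxx mulr1.
have [b ob] := order_mod_exists nci.
have [t dt] := degree_mod_exists (core_ideal idP) nci.
have le_bt : (b <= t)%N.
  by rewrite leqNgt; apply/negP => lt_tb; apply: dt.1; apply: ob.2.
by exists (t - b)%N, b; rewrite subnKC.
Qed.

Lemma core_compW P x i : ideal P -> core P x -> core P (phi x)`_i.
Proof. by move=> idP cx; apply: core_comp. Qed.

Lemma width_mod_ncore P x w : ideal P -> width_mod (core P) x w -> ~ core P x.
Proof. by move=> idP [b [[nb _] _]] cx; apply: nb; apply: core_compW. Qed.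

Lemma width_mod_congr P x y w :
  ideal P -> core P (x - y) -> width_mod (core P) x w -> width_mod (core P) y w.
Proof.
move=> idP cxy; have cE i : core P (phi x)`_i <-> core P (phi y)`_i.
  have := core_compW i idP cxy; rewrite rmorphB coefB => cxyi.
  by split=> ?; [apply: ideal_subr cxyi|apply: ideal_subl cxyi] => //; apply: core_ideal.
move=> [b [[nb ltb] [nt ltt]]]; exists b; split; split.
- by rewrite -cE.
- by move=> i /ltb; rewrite cE.
- by rewrite -cE.
- by move=> i /ltt; rewrite cE.
Qed.

Lemma width_mod_homog P x e :
  ideal P -> phi x = x *: 'X^e -> ~ core P x -> width_mod (core P) x 0.
Proof.
move=> idP hx ncx; have c0 := ideal_mem0 (core_ideal idP).
have xe : ~ core P (x *: 'X^e)`_e by rewrite coefZ coefXn eqxx mulr1.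
have xi i : i != e -> core P (x *: 'X^e)`_i.
  by rewrite coefZ coefXn => /negPf ->; rewrite mulr0.
exists e; rewrite addn0 hx; split; split=> // i ltie; apply: xi; first by rewrite ltn_eqF.
by rewrite gtn_eqF.
Qed.

(** With [h] and [c] the top components of [p] and [x], the top terms of [h x] and [c p] cancel in
    degree [a + u + b + w], while [w <= u] keeps the order at least [a + b + w]. The width therefore
    drops below [u]. *)
Lemma width_mod_division P x p u w :
    prime_ideal P -> width_mod (core P) x u -> width_mod (core P) p w -> (w <= u)%N ->
  exists h c, [/\ exists e, phi h = h *: 'X^e, ~ core P h &
    core P (h * x - c * p) \/
    exists2 u', (u' < u)%N & width_mod (core P) (h * x - c * p) u'].
Proof.
move=> prP [a [[na lta] [nd ltd]]] [b [[nb ltb] [nt ltt]]] le_wu.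
have idP := prime_ideal_ideal prP; have idC := core_ideal idP.
pose h := (phi p)`_(b + w); pose c := (phi x)`_(a + u).
exists h, c; split=> //; first by exists (b + w)%N; apply: phi_comp.
have zE i : (phi (h * x - c * p))`_i =
    h * (if (i < b + w)%N then 0 else (phi x)`_(i - (b + w)))
    - c * (if (i < a + u)%N then 0 else (phi p)`_(i - (a + u))).
  by rewrite rmorphB !rmorphM /= !phi_comp coefB -!scalerAl !coefZ !coefXnM.
have lowC i : (i < a + (b + w))%N -> core P (phi (h * x - c * p))`_i.
  move=> lti; rewrite zE; apply: (ideal_memB idC); apply: (ideal_memMl _ idC).
    by case: ltnP => ?; [apply: (ideal_mem0 idC)|apply: lta; lia].
  by case: ltnP => ?; [apply: (ideal_mem0 idC)|apply: ltb; lia].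
have highC i : (a + u + (b + w) <= i)%N -> core P (phi (h * x - c * p))`_i.
  rewrite leq_eqVlt => /predU1P [<-|lti].
    rewrite zE !ltnNge leq_addl leq_addr /= addnK addKn /h /c mulrC subrr; exact: (ideal_mem0 idC).
  rewrite zE; apply: (ideal_memB idC); apply: (ideal_memMl _ idC).
    by case: ltnP => ?; [apply: (ideal_mem0 idC)|apply: ltd; lia].
  by case: ltnP => ?; [apply: (ideal_mem0 idC)|apply: ltt; lia].
have [|ncz] := classic (core P (h * x - c * p)); [by left|right].
have [u' wu'] := width_mod_exists idP ncz; exists u' => //.
have [b' [[nb' _] [nt' _]]] := wu'.
have le_b' : (a + (b + w) <= b')%N by rewrite leqNgt; apply/negP => /lowC.
have lt_t' : (b' + u' < a + u + (b + w))%N by rewrite ltnNge; apply/negP => /highC.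
lia.
Qed.

(* Modulo [core P] the homogeneous elements become invertible in the graded
   localisation, which is k or k[t, t^-1]: hence no prime lies strictly between
   [core P] and [P].  Elements of least width play the role of generators. *)
Lemma no_prime_above_core P Q :
    prime_ideal P -> prime_ideal Q -> (forall x, Q x -> P x) ->
    (forall x, core P x -> core Q x) -> (exists2 q, Q q & ~ core P q) ->
  forall x, P x -> Q x.
Proof.
move=> prP prQ QP cPQ [q0 Qq0 nq0].
have [idP idQ] := (prime_ideal_ideal prP, prime_ideal_ideal prQ).
have cQP x : core Q x -> core P x by move=> cx i; apply/QP/cx.
have prC := core_prime prP; have idC := core_ideal idP.
have [w0 wq0] := width_mod_exists idP nq0.
(* An element [p] of least width generates [P] modulo [core P], up to homogeneous multipliers [h]
   outside the core; repeated division shows this. *)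
have [w [p [Pp wp]] w_min] := @least_nat (fun w => exists p, P p /\ width_mod (core P) p w) w0
  (ex_intro _ q0 (conj (QP _ Qq0) wq0)).
have gen x : P x -> exists h c,
    [/\ exists e, phi h = h *: 'X^e, ~ core P h & core P (h * x - c * p)].
  move=> Px; have [cx|ncx] := classic (core P x).
    exists 1, 0; split; first by exists 0%N; rewrite rmorph1 expr0 scale1r.
      by case: prC.
    by rewrite mul1r mul0r subr0.
  have [u wx] := width_mod_exists idP ncx.
  elim/ltn_ind: u x wx Px {ncx} => u IHu x wx Px.
  have le_wu : (w <= u)%N by rewrite leqNgt; apply/negP => /w_min; apply; exists x.
  have [h [c [[e he] nh [cr|[u' lt_u' wr]]]]] := width_mod_division prP wx wp le_wu.
    by exists h, c; split=> //; exists e.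
  have [|h' [c' [[e' he'] nh' cr']]] := IHu u' lt_u' _ wr.
    by apply: ideal_memB => //; apply: ideal_memMl.
  exists (h' * h), (h' * c + c'); split.
  - by exists (e' + e)%N; rewrite rmorphM /= he he' -scalerAl -scalerAr scalerA -exprD.
  - by case/(prime_idealM prC).
  - by rewrite (_ : _ - _ = h' * (h * x - c * p) - c' * p) //; ring.
(* An element of width 0 is homogeneous modulo [core P], so its single remaining component would lie
   in [P], hence in the core. *)
have w_gt0 : (0 < w)%N.
  rewrite lt0n; apply/eqP => w0E; move: wp; rewrite {}w0E => -[b [[nb ltb] [_ ltt]]].
  rewrite addn0 in ltt; apply: nb; apply: core_comp => //.
  have pE := sum_comp p; have [ltbs|lesb] := ltnP b (size (phi p)); last first.
    by rewrite nth_default //; apply: ideal_mem0.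
  rewrite (bigD1 (Ordinal ltbs)) //= in pE.
  have Prest : P (\sum_(i < size (phi p) | i != Ordinal ltbs) (phi p)`_i).
    apply: ideal_sum => // i; rewrite -val_eqE /= neq_ltn => /orP[/ltb|/ltt] ci; exact: core_sub ci.
  by rewrite -(addrK (\sum_(i < size (phi p) | i != Ordinal ltbs) (phi p)`_i) (phi p)`_b) -pE;
    apply: ideal_memB.
have [Qp|nQp] := classic (Q p).
  move=> x /gen [h [c [[e he] nh cr]]].
  have Qhx : Q (h * x).
    apply: (ideal_subl idQ (ideal_memMl c idQ Qp)); exact: (core_sub idQ (cPQ _ cr)).
  case: (prime_idealM prQ Qhx) => // Qh; case: nh; apply: cQP => i.
  by rewrite he coefZ coefXn; case: eqP; rewrite ?mulr1 ?mulr0 // => _; apply: ideal_mem0.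
(* When [p] is outside [Q], the relation [h q = c p] modulo [core P] puts [c] in [Q], with width
   [v - w]. As [w > 0], this contradicts the minimality of [v]. *)
have [v [q [Qq wq]] v_min] := @least_nat (fun w => exists q, Q q /\ width_mod (core P) q w) w0
  (ex_intro _ q0 (conj Qq0 wq0)).
have [h [c [[e he] nh cr]]] := gen q (QP q Qq).
have Qc : Q c.
  have Qcp : Q (c * p).
    apply: (ideal_subr idQ (ideal_memMl h idQ Qq)); exact: (core_sub idQ (cPQ _ cr)).
  by case: (prime_idealM prQ Qcp).
have whq : width_mod (core P) (h * q) v.
  by rewrite -[v]add0n; apply: width_modM => //; apply: width_mod_homog he nh.
have wcp := width_mod_congr idP cr whq.
have [|k wc] := @width_mod_exists P c idP.
  by move=> cc; apply: (width_mod_ncore idP wcp); apply: (ideal_memMr _ idC).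
have vE := width_mod_uniq wcp (width_modM prC wc wp).
by case: (v_min k); [rewrite vE -{1}[k]addn0 ltn_add2l|exists c].
Qed.

(** At the last step from [P] to [Q], either [core P] lies strictly below [core Q] and induction
    applies, or the two cores agree. In the latter case no prime fits strictly between [core Q] and
    [Q], so [core Q] is [P]. *)
Lemma height_ge_core n P : height_ge n P -> height_ge n.-1 (core P).
Proof.
elim=> [{}P prP|{}n {}P Q htP IH prQ [PQ [q [Qq nPq]]]] /=.
  exact/height_ge0/core_prime.
have prP := height_ge_prime htP.
have [idP idQ] := (prime_ideal_ideal prP, prime_ideal_ideal prQ).
have cPQ x : core P x -> core Q x by move=> cx i; apply/PQ/cx.
have [cQP|ncQP] := classic (forall x, core Q x -> core P x); last first.
  case: n htP IH => [|n] _ IH; first exact/height_ge0/core_prime.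
  apply: height_geS IH _ _; first exact: core_prime.
  by split=> //; have [x ncx] := not_all_ex_not _ _ ncQP; exists x; apply: imply_to_and ncx.
have cQ x : core Q x <-> P x.
  split=> [/cQP /core_sub|Px]; first exact.
  apply: NNPP => ncx; apply: nPq; apply: (no_prime_above_core prQ prP) => //.
  by exists x.
case: n htP {IH} => [|n] htP; first exact/height_ge0/core_prime.
(* [core Q] and [P] are only equivalent as predicates, so the last step of the chain is rebuilt with
   [core Q] on top. *)
inversion htP as [|? P' ? htP' _ [P'P [x [Px nP'x]]]]; subst.
apply: height_geS htP' _ _; first exact: core_prime.
by split=> [y /P'P /cQ|] //; exists x; split=> //; apply/cQ.
Qed.

(* In a counterexample, [Q] (or [core Q]), then [{x | x_0 \in Q}], then a prime containing
   it together with [s] would make a chain of length [n + 1]. *)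
Lemma meets_shifted_monoid n s Q :
    @noetherian R -> (forall P, ~ height_ge n.+1 P) ->
    phi s = s%:P -> height_ge n Q ->
  exists2 t, (exists k r, phi r = r%:P /\ t = s ^+ k * (1 + s * r)) & Q t.
Proof.
move=> noethR dimR phis htQ; apply: NNPP => noT.
have nQs k r : phi r = r%:P -> ~ Q (s ^+ k * (1 + s * r)).
  by move=> hr Qt; apply: noT; exists (s ^+ k * (1 + s * r)) => //; exists k, r.
have prQ := height_ge_prime htQ; have idQ := prime_ideal_ideal prQ.
have phi0 x : phi (phi x)`_0 = ((phi x)`_0)%:P by rewrite phi_comp expr0 alg_polyC.
have nQs1 : ~ Q s.
  by move=> Qs; apply: (nQs 1%N 0); rewrite ?rmorph0 //; apply: ideal_memMr; rewrite ?expr1.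
(* The inverse image of [(Q \cap R_0) + s R_0] under [x |-> x_0]. It is proper because [Q] contains
   no [1 + s r] with [r] in [R_0]. *)
pose J x := exists r, phi r = r%:P /\ Q ((phi x)`_0 - s * r).
have idJ : ideal J.
  split=> //.
  - by exists 0; rewrite !rmorph0 coef0 mulr0 subrr; split=> //; apply: ideal_mem0.
  - move=> x y [r [hr Qr]] [u [hu Qu]]; exists (r - u); rewrite !rmorphB /= hr hu coefB.
    split=> //; rewrite (_ : _ - _ = ((phi x)`_0 - s * r) - ((phi y)`_0 - s * u)); last by ring.
    exact: ideal_memB.
  - move=> a x _ [r [hr Qr]]; exists ((phi a)`_0 * r); rewrite !rmorphM /= phi0 hr.
    split=> //; rewrite coef0M (_ : _ - _ = (phi a)`_0 * ((phi x)`_0 - s * r)); last by ring.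
    exact: ideal_memMl.
have [||N [prN JN _]] := @exists_prime_avoiding _ J (fun t => t = 1) noethR idJ.
- by split=> // _ _ -> ->; rewrite mulr1.
- move=> _ -> [r [hr]]; rewrite rmorph1 coef1 /= => Q1; apply: (nQs 0%N (- r)).
    by rewrite !rmorphN /= hr.
  by rewrite expr0 mul1r mulrN.
have Ns : N s.
  apply: JN; exists 1; rewrite rmorph1 phis coefC mulr1 subrr.
  by split=> //; apply: ideal_mem0.
pose L x := Q (phi x)`_0.
have prL : prime_ideal L.
  split; first split=> //.
  - by rewrite /L rmorph0 coef0; apply: ideal_mem0.
  - by move=> x y Lx Ly; rewrite /L rmorphB coefB; apply: ideal_memB.
  - by move=> a x _ Lx; rewrite /L rmorphM coef0M; apply: ideal_memMl.
  - by rewrite /L rmorph1 coef1; case: prQ.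
  - by move=> a b _ _; rewrite /L rmorphM coef0M => /(prime_idealM prQ).
have LJ x : L x -> J x.
  by move=> Lx; exists 0; rewrite rmorph0 mulr0 subr0.
have LN : strict_incl L N.
  by split=> [x /LJ /JN|] //; exists s; rewrite /L phis coefC.
have [QC|] := classic (forall x, Q x -> core Q x).
  apply: (dimR N); apply: height_geS htQ prN _; split=> [x /QC cx|]; last by exists s.
  exact/JN/LJ/cx.
move=> /not_all_ex_not [x nQC]; have [Qx ncx] := imply_to_and _ _ nQC.
(* If [L] were inside [core Q], then [x - x_0] would be in the core, so [x_0] would be in [Q] and
   [x] in [core Q]. *)
have htL : height_ge n.-1.+1 L.
  apply: (height_geS (height_ge_core htQ) prL); split=> [y cy|]; first exact: cy.
  apply: NNPP => noL; apply: ncx.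
  have Lcore y : L y -> core Q y by move=> Ly; apply: NNPP => ncy; apply: noL; exists y.
  have idL := prime_ideal_ideal prL; have idC := core_ideal idQ.
  have cx0 : core Q (x - (phi x)`_0).
    by apply: Lcore; rewrite /L rmorphB phi0 coefB coefC subrr; apply: ideal_mem0.
  apply: (ideal_subl idC _ cx0); apply: core_comp => //.
  apply: (ideal_subr idQ Qx); exact: core_sub cx0.
(* For [n = 0] the index [n.-1.+1] is 1, so [L] alone already exceeds the dimension. *)
by case: n dimR htQ htL => [|n] dimR _ htL; [exact: dimR htL|apply: (dimR N); apply: height_geS htL prN LN].
Qed.
End Grading.

(** * Completion of rows and patching *)

Lemma map_mx_unitmx (R S : comUnitRingType) (f : {rmorphism R -> S}) n (A : 'M_n) :
  A \in unitmx -> map_mx f A \in unitmx /\ map_mx f (invmx A) = invmx (map_mx f A).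
Proof.
move=> uA; have AV : map_mx f A *m map_mx f (invmx A) = 1%:M.
  by rewrite -map_mxM mulmxV // map_mx1.
have [ufA _] := mulmx1_unit AV; split=> //.
by rewrite -[LHS](mulKmx ufA) AV mulmx1.
Qed.

Lemma scalemx_inj (R : idomainType) m n (t : R) : t != 0 ->
  injective (fun A : 'M[R]_(m, n) => t *: A).
Proof.
by move=> t0 A B /matrixP eqAB; apply/matrixP => i j; have := eqAB i j; rewrite !mxE => /(mulfI t0).
Qed.

(** * Matrices homotopic to the identity *)

Section Hgrp.
Variables (R : idomainType) (n : nat).
Implicit Types a b : 'M[R]_n.

(** Evaluation is restated as the ring morphism [horner_eval], to which the [map_mx] lemmas
    apply. *)
Lemma HgrpP a : Hgrp a <-> exists th : 'M[{poly R}]_n,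
  [/\ th \in unitmx, map_mx (horner_eval 0) th = 1%:M & map_mx (horner_eval 1) th = a].
Proof. by []. Qed.

Lemma Hgrp_unitmx a : Hgrp a -> a \in unitmx.
Proof. by case/HgrpP => th [uth _ <-]; case: (map_mx_unitmx (horner_eval 1) uth). Qed.

Lemma Hgrp_mul a b : Hgrp a -> Hgrp b -> Hgrp (a *m b).
Proof.
move=> /HgrpP [th [uth th0 <-]] /HgrpP [et [uet et0 <-]]; apply/HgrpP; exists (th *m et).
by rewrite unitmx_mul uth uet !map_mxM th0 et0 mulmx1.
Qed.

Lemma Hgrp_inv a : Hgrp a -> Hgrp (invmx a).
Proof.
move=> /HgrpP [th [uth th0 <-]]; apply/HgrpP; exists (invmx th).
rewrite unitmx_inv uth.
have [_ ->] := map_mx_unitmx (horner_eval 0) uth.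
have [_ ->] := map_mx_unitmx (horner_eval 1) uth.
by rewrite th0 invmx1.
Qed.

(** The homotopy is [1 + X N], with inverse [1 - X N]. *)
Lemma Hgrp_square_zero (N : 'M[R]_n) : N *m N = 0 -> Hgrp (1%:M + N).
Proof.
move=> NN; apply/HgrpP.
pose NX : 'M[{poly R}]_n := 'X *: map_mx polyC N.
have evN u : map_mx (horner_eval u) (1%:M + NX) = 1%:M + u *: N.
  rewrite map_mxD map_mx1; congr (_ + _); apply/matrixP => i j.
  by rewrite /NX !mxE /= /horner_eval hornerM hornerX hornerC.
exists (1%:M + NX); split; last 2 first.
- by rewrite evN scale0r addr0.
- by rewrite evN scale1r.
have : (1%:M + NX) *m (1%:M - NX) = 1%:M.
  rewrite mulmxBr mulmxDl !mul1mx !mulmx1 mulmxDl mul1mx.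
  by rewrite /NX -scalemxAl -scalemxAr -map_mxM NN map_mx0 !scaler0 addr0 addrK.
by case/mulmx1_unit.
Qed.
End Hgrp.

(** * Column operations on a row, with denominators cleared *)

Section RowReduction.
Variables (R : idomainType) (n : nat).
Implicit Types (v : 'rV[R]_n.+1) (I : R -> Prop).

Lemma e1_row_mx : @e1 R n = row_mx 1%:M 0 :> 'rV_(1 + n).
Proof.
apply/rowP => j; rewrite !mxE; case: splitP => k jk; rewrite !mxE.
  by rewrite !ord1 eqxx -val_eqE /= jk ord1.
by rewrite eqxx -val_eqE /= jk.
Qed.

Definition row_head v : R := v 0 0.
Definition row_tail v : 'rV[R]_n := rsubmx (v : 'rV_(1 + n)).

Lemma row_mx_head_tail v : v = row_mx (row_head v)%:M (row_tail v) :> 'rV_(1 + n).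
Proof.
rewrite -[LHS](@hsubmxK _ 1 1 n); congr row_mx; apply/rowP => j; rewrite !mxE ord1 eqxx mulr1n.
by congr (v _ _); apply: val_inj.
Qed.

Lemma unimodular_head_tail v :
  unimodular v -> exists r, add_row (fun x => x = 0) (row_tail v) (1 - row_head v * r).
Proof.
case=> w; rewrite {1}[v]row_mx_head_tail -[w](@vsubmxK _ 1 n 1) (@mul_row_col _ 1 1 n 1) => vw.
exists (usubmx (w : 'M_(1 + n, 1)) 0 0), (dsubmx (w : 'M_(1 + n, 1))).
have {}vw : row_head v * usubmx (w : 'M_(1 + n, 1)) 0 0
    + (row_tail v *m dsubmx (w : 'M_(1 + n, 1))) 0 0 = 1.
  by have /matrixP/(_ 0 0) := vw; rewrite mul_scalar_mx [LHS]mxE [in LHS]mxE [RHS]mxE eqxx mulr1n.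
by rewrite -vw; ring.
Qed.

(* With [b' = b + a y] and [t] in the ideal of [b'], the column operations
   [b -> b'], then adding the multiple [(1 - a) t] of [t] to [t a], then clearing [b'],
   turn [(a, b)] into [(t, 0)]. *)
Lemma row_reduction I v (y : 'rV[R]_n) t :
    ideal I -> add_row I (row_tail v + row_head v *: y) t ->
  exists M M' : 'M[R]_n.+1,
    [/\ M *m M' = (t ^+ 2)%:M, M' *m M = (t ^+ 2)%:M,
        forall j, I ((v *m M - t *: @e1 R n) 0 j) & t = 1 -> Hgrp M].
Proof.
set a := row_head v; set b := row_tail v => idI [c Itc].
pose b' := b + a *: y.
pose N1 : 'M[R]_(1 + n) := block_mx 0 y 0 0.
pose N2 : 'M[R]_(1 + n) := block_mx 0 0 ((1 - a) *: c) 0.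
pose N3 : 'M[R]_(1 + n) := block_mx 0 (- b') 0 0.
have N11 : N1 *m N1 = 0 by rewrite mulmx_block !(mul0mx, mulmx0, addr0) block_mx0.
have N22 : N2 *m N2 = 0 by rewrite mulmx_block !(mul0mx, mulmx0, addr0) block_mx0.
have N33 : N3 *m N3 = 0 by rewrite mulmx_block !(mul0mx, mulmx0, addr0) block_mx0.
have sqDB (s : R) (N : 'M[R]_(1 + n)) : N *m N = 0 -> (s%:M + N) *m (s%:M - N) = (s ^+ 2)%:M.
  move=> NN; rewrite mulmxBr !mulmxDl NN !mul_mx_scalar !mul_scalar_mx addr0 addrK.
  by rewrite scale_scalar_mx.
have sqBD (s : R) (N : 'M[R]_(1 + n)) : N *m N = 0 -> (s%:M - N) *m (s%:M + N) = (s ^+ 2)%:M.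
  by move=> NN; rewrite -{2}[N]opprK sqDB // mulNmx mulmxN opprK.
(* The middle factor is [t] times the elementary matrix [1 + N2 / t]; this is the source of the
   scalar [t^2]. *)
exists ((1%:M + N1) *m (t%:M + N2) *m (1%:M + N3)).
exists ((1%:M - N3) *m (t%:M - N2) *m (1%:M - N1)).
have three (A A' B B' C C' : 'M[R]_(1 + n)) : A *m A' = 1%:M -> B *m B' = (t ^+ 2)%:M ->
    C *m C' = 1%:M -> (A *m B *m C) *m (C' *m B' *m A') = (t ^+ 2)%:M.
  move=> AA BB CC; rewrite !mulmxA -[_ *m C *m C']mulmxA CC mulmx1.
  by rewrite -[_ *m B *m B']mulmxA BB mul_mx_scalar -scalemxAl AA scale_scalar_mx mulr1.
split.
- by apply: three; rewrite ?sqDB ?expr1n.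
- by apply: three; rewrite ?sqBD ?expr1n.
- pose e := (b' *m c) 0 0.
  pose f := t * a + (1 - a) * e.
  have step1 : v *m (1%:M + N1) = row_mx a%:M b' :> 'rV_(1 + n).
    rewrite [v]row_mx_head_tail mulmxDr mulmx1 (@mul_row_block _ 1 1 n 1 n) !(mulmx0, addr0).
    by rewrite mul_scalar_mx add_row_mx addr0.
  have step2 : row_mx a%:M b' *m (t%:M + N2) = row_mx f%:M (t *: b').
    rewrite mulmxDr mul_mx_scalar scale_row_mx mul_row_block !(mulmx0, add0r).
    rewrite add_row_mx addr0 scale_scalar_mx -scalemxAr [b' *m c]mx11_scalar -/e scale_scalar_mx.
    by rewrite -raddfD.
  have step3 : row_mx f%:M (t *: b') *m (1%:M + N3) = row_mx f%:M ((t - f) *: b').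
    rewrite mulmxDr mulmx1 mul_row_block !(mulmx0, addr0).
    by rewrite mul_scalar_mx add_row_mx addr0 scalerN -scalerBl.
  have vM : v *m ((1%:M + N1) *m (t%:M + N2) *m (1%:M + N3)) = row_mx f%:M ((t - f) *: b').
    by rewrite !mulmxA step1 step2 step3.
  (* Since [e] is congruent to [t] modulo [I], so is [f], and both blocks of the error are multiples
     of [f - t]. *)
  have Ift : I (f - t).
    rewrite (_ : f - t = (a - 1) * (t - e)); last by rewrite /f; ring.
    exact: ideal_memMl.
  move=> j; rewrite vM e1_row_mx (@scale_row_mx _ 1 1 n) (@opp_row_mx _ 1 1 n) (@add_row_mx _ 1 1 n) scaler0 subr0.
  rewrite mxE; case: splitP => k _; rewrite !mxE.
    by rewrite !ord1 eqxx mulr1n mulr1.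
  by rewrite -opprB mulNr -mulrN; apply: ideal_memMr.
- move=> ->; apply: Hgrp_mul; [apply: Hgrp_mul|]; exact: Hgrp_square_zero.
Qed.
End RowReduction.

(** * Comparing two specializations of a row *)

Section Patching.
Variables (R : idomainType) (n : nat).
Implicit Types (v : 'rV[R]_n.+1) (t : R) (psi chi : {rmorphism R -> R}).

(** The form without denominators of equivalence to [e_1] over [R_t]: the matrix is [M / t], with
    inverse [M' / t]. *)
Definition reduces_to_scalar v t :=
  t != 0 /\ exists M M' : 'M[R]_n.+1,
    [/\ M *m M' = (t ^+ 2)%:M, M' *m M = (t ^+ 2)%:M & v *m M = t *: @e1 R n].

Lemma map_e1 psi : map_mx psi (@e1 R n) = @e1 R n.
Proof. exact: map_delta_mx. Qed.

(* [psi(M) chi(M')] agrees with [psi(M M') = t^2] modulo [t^2], so it is [t^2]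
   times an invertible matrix. *)
Lemma specialization_equiv psi chi v t :
    reduces_to_scalar v t -> psi t = t -> chi t = t ->
    (forall x, exists r, psi x - chi x = t ^+ 2 * r) ->
  exists2 A : 'M[R]_n.+1, A \in unitmx & map_mx psi v *m A = map_mx chi v.
Proof.
move=> [t0 [M [M' [MM' M'M vM]]]] psit chit cong.
have [g gE] : exists g : R -> R, forall x, psi x - chi x = t ^+ 2 * g x.
  exists (fun x => sval (constructive_indefinite_description _ (cong x))) => x.
  exact: svalP (constructive_indefinite_description _ (cong x)).
pose B := map_mx g M'.
have BE : map_mx psi M' = map_mx chi M' + t ^+ 2 *: B.
  by apply/matrixP => i j; rewrite !mxE -gE addrC subrK.
have mapt2 (f : {rmorphism R -> R}) : f t = t -> map_mx f ((t ^+ 2)%:M : 'M_n.+1) = (t ^+ 2)%:M.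
  by move=> ft; rewrite map_scalar_mx /= rmorphXn /= ft.
pose A := 1%:M - map_mx psi M *m B; pose A' := 1%:M + map_mx chi M *m B.
have AE : map_mx psi M *m map_mx chi M' = t ^+ 2 *: A.
  rewrite -[map_mx chi M'](addrK (t ^+ 2 *: B)) -BE mulmxBr -map_mxM MM' mapt2 //.
  by rewrite -scalemxAr -scalemx1 -scalerBr.
(* Exchanging [psi] and [chi] gives the inverse: the product of the two left sides collapses to
   [t^4], and [t] cancels in a domain. *)
have A'E : map_mx chi M *m map_mx psi M' = t ^+ 2 *: A'.
  by rewrite BE mulmxDr -map_mxM MM' mapt2 // -scalemxAr -scalemx1 -scalerDr.
have t20 : t ^+ 2 != 0 by rewrite expf_eq0.
have AA' : A *m A' = 1%:M.
  apply: (scalemx_inj t20); apply: (scalemx_inj t20) => /=.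
  rewrite scalemxAr scalemxAl -AE -A'E !mulmxA -[_ *m map_mx chi M' *m _]mulmxA -map_mxM M'M mapt2 //.
  by rewrite mul_mx_scalar -scalemxAl -map_mxM MM' mapt2 // scalemx1.
exists A; first by case/mulmx1_unit: AA'.
apply: (scalemx_inj t20) => /=; rewrite scalemxAr -AE mulmxA -map_mxM vM.
rewrite map_mxZ /= psit map_e1 -[in t *: _]chit -(map_e1 chi) -map_mxZ -vM map_mxM -mulmxA -map_mxM MM' mapt2 //.
by rewrite mul_mx_scalar.
Qed.
End Patching.

(** * Graded domains *)

Section GradedCompletion.
Variables (R : idomainType) (phi : {rmorphism R -> {poly R}}) (n : nat).
Hypotheses (noethR : @noetherian R) (phiP : grading_morphism phi).
Hypothesis dimR : forall P : R -> Prop, ~ height_ge n.+1 P.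
Implicit Types (v : 'rV[R]_n.+1).

Lemma zero_prime : prime_ideal (fun x : R => x = 0).
Proof.
split; first split=> //.
- by move=> x y -> ->; rewrite subr0.
- by move=> s x _ ->; rewrite mulr0.
- by move=> /eqP; rewrite oner_eq0.
- by move=> a b _ _ /eqP; rewrite mulf_eq0 => /orP[] /eqP; [left|right].
Qed.

Lemma height_ge1 (P : R -> Prop) x : prime_ideal P -> P x -> x <> 0 -> height_ge 1 P.
Proof.
move=> prP Px x0; apply: (height_geS (height_ge0 zero_prime) prP); split; last by exists x.
by move=> _ ->; apply: (ideal_mem0 (prime_ideal_ideal prP)).
Qed.

(* The zero prime lies strictly below every prime containing [I], which saves one
   dimension modulo [I]. *)
Lemma stable_range_quotient (I : R -> Prop) v x :
    ideal I -> I x -> x <> 0 -> unimodular v ->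
  exists y : 'rV[R]_n, add_row I (row_tail v + row_head v *: y) 1.
Proof.
move=> idI Ix x0 uv.
have mon1 : monoid (fun t : R => t = 1) by split=> // _ _ -> ->; rewrite mulr1.
have [P prP IP|Q htQ|y [_ ->]] :=
  @stable_range _ I _ 1 n _ _ noethR idI mon1 _ _ (unimodular_head_tail uv).
- exact: height_ge1 prP (IP x Ix) x0.
- by case: (dimR htQ).
- by exists y.
Qed.

Lemma add_row_shift (I : R -> Prop) m (b y : 'rV[R]_m) s x :
    ideal I -> add_row I b x -> exists r, add_row I (b + s *: y) (x - s * r).
Proof.
move=> idI [c Ix]; exists (- (y *m c) 0 0), c.
have -> : ((b + s *: y) *m c) 0 0 = (b *m c) 0 0 + s * (y *m c) 0 0.
  by rewrite mulmxDl -scalemxAl mxE; congr (_ + _); rewrite mxE.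
by rewrite (_ : _ - _ = x - (b *m c) 0 0) //; ring.
Qed.

(** The stable range is used first modulo [s], then for the monoid [s^N (1 + s R_0)]. The second
    time [a s] replaces [a], so that [s] remains invertible modulo the tail and its powers can be
    cancelled. *)
Lemma unimodular_up_to_degree0 v s :
    unimodular v -> phi s = s%:P -> s <> 0 ->
  exists y r, phi r = r%:P /\
    add_row (fun x => x = 0) (row_tail v + row_head v *: y) (1 + s * r).
Proof.
move=> uv phis s0; set a := row_head v; set b := row_tail v.
have id0 := prime_ideal_ideal zero_prime.
have idS := add_principal_ideal s id0.
have [y1 [c1 [r1 b1_1]]] := stable_range_quotient idS (add_principal_gen s id0) s0 uv.
rewrite -/a -/b in b1_1; set b1 := b + a *: y1 in b1_1.
pose J (b' : 'rV[R]_n) := add_row (fun x : R => x = 0) b'.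
have idJ b' : ideal (J b') by apply: add_row_ideal.
have Js : J b1 (1 - s * r1).
  by exists c1; rewrite -[RHS]b1_1; ring.
have [r Ja0] := unimodular_head_tail uv.
have [r' Ja] := add_row_shift y1 a id0 Ja0; rewrite -/a -/b -/b1 in Ja.
(* Both [a] and [s] are invertible modulo the entries of [b1], hence so is [a s]. *)
have Jas : J b1 (1 - (a * s) * ((r + r') * r1)).
  rewrite (_ : _ - _ = (1 - a * r - a * r') + a * (r + r') * (1 - s * r1)); last by ring.
  by apply: (ideal_memD (idJ b1)) => //; apply: (ideal_memMl _ (idJ b1)).
have monS : monoid (fun t => exists k r, phi r = r%:P /\ t = s ^+ k * (1 + s * r)).
  split; first by exists 0%N, 0; rewrite !rmorph0; split=> //; ring.
  move=> _ _ [k [u [hu ->]]] [l [w [hw ->]]]; exists (k + l)%N, (u + w + s * u * w).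
  by split; [rewrite !rmorphD !rmorphM /= phis hu hw|rewrite exprD; ring].
have [P prP _|Q htQ|y2 [_ [k [q [hq ->]]] Jt]] :=
  @stable_range _ _ _ 0 n _ _ noethR id0 monS _ _ (ex_intro (fun r => J b1 (1 - a * s * r)) _ Jas).
- exact: height_ge0.
- exact: (meets_shifted_monoid phiP noethR dimR phis).
exists (y1 + s *: y2), q; split=> //.
have b2E : b + a *: (y1 + s *: y2) = b1 + (a * s) *: y2.
  by rewrite scalerDr scalerA addrA.
rewrite b2E -/(J _); set b2 := b1 + _ in Jt b2E *.
have [r2 Js2] := add_row_shift y2 (a * s) id0 Js; rewrite -/b2 -/(J b2) in Js2.
(* Modulo the entries of [b2], [s] has inverse [r1 + a r2], so one factor [s] is removed at a
   time. *)
elim: k Jt => [|k IHk]; first by rewrite expr0 mul1r.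
move=> Jt; apply: IHk; rewrite -/(J b2) in Jt *.
rewrite (_ : s ^+ k * _ = s ^+ k * (1 + s * q) * (1 - s * r1 - a * s * r2)
   + (r1 + a * r2) * (s ^+ k.+1 * (1 + s * q))); last by rewrite exprS; ring.
by apply: (ideal_memD (idJ b2)); apply: (ideal_memMl _ (idJ b2)).
Qed.

Lemma reduces_to_scalar_degree0 v s :
    unimodular v -> phi s = s%:P -> s <> 0 ->
  exists r, phi r = r%:P /\ (1 + s * r != 0 -> reduces_to_scalar v (1 + s * r)).
Proof.
move=> uv phis s0; have [y [r [hr Jt]]] := unimodular_up_to_degree0 uv phis s0.
exists r; split=> // t0; split=> //.
have [M [M' [MM' M'M vM _]]] := row_reduction (prime_ideal_ideal zero_prime) Jt.
exists M, M'; split=> //; apply/subr0_eq/rowP => j; rewrite [RHS]mxE; exact: vM.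
Qed.

(** The endomorphism [x_i |-> u^i x_i] on components: the identity at 1 and the projection onto
    degree zero at 0. *)
Definition specialize (u : R) : {rmorphism R -> R} := horner_eval u \o phi.

Lemma specialize_sub u w x : exists r, specialize u x - specialize w x = (u - w) * r.
Proof.
have : root (phi x - (phi x).[w]%:P) w by rewrite /root hornerD hornerN hornerC subrr.
case/factor_theorem => q qE; exists q.[u].
have := congr1 (horner^~ u) qE; rewrite hornerM hornerXsubC hornerD hornerN hornerC.
by rewrite mulrC.
Qed.

Lemma specialize_deg0 u t : phi t = t%:P -> specialize u t = t.
Proof. by move=> ht; rewrite /specialize /= ht /horner_eval hornerC. Qed.

Lemma specialize1 x : specialize 1 x = x. Proof. exact: phiP.1. Qed.

Lemma specialize0 x : specialize 0 x = (phi x)`_0.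
Proof. by rewrite /specialize /= /horner_eval horner_coef0. Qed.

(** The parameter moves from 1 to [w = t'^2 z'] and then to 0. The first step has length [t^2 z] and
    the second [t'^2 z'], so each is covered by one of the two reductions. *)
Lemma graded_patching v t t' z z' :
    reduces_to_scalar v t -> reduces_to_scalar v t' ->
    phi t = t%:P -> phi t' = t'%:P -> t ^+ 2 * z + t' ^+ 2 * z' = 1 ->
    map_mx (specialize 0) v = @e1 R n ->
  exists2 A : 'M[R]_n.+1, A \in unitmx & v *m A = @e1 R n.
Proof.
move=> vt vt' ht ht' comax v0; set w := t' ^+ 2 * z'.
have [|A uA vA] := specialization_equiv (psi := specialize 1) (chi := specialize w) vt
  (specialize_deg0 1 ht) (specialize_deg0 w ht).
  move=> x; have [r ->] := specialize_sub 1 w x; exists (z * r).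
  by rewrite -comax /w; ring.
have [|B uB vB] := specialization_equiv (psi := specialize w) (chi := specialize 0) vt'
  (specialize_deg0 w ht') (specialize_deg0 0 ht').
  move=> x; have [r ->] := specialize_sub w 0 x; exists (z' * r).
  by rewrite /w; ring.
exists (A *m B); first by rewrite unitmx_mul uA.
have v1 : map_mx (specialize 1) v = v by apply/matrixP => i j; rewrite mxE specialize1.
by rewrite mulmxA -{1}v1 vA vB.
Qed.

Lemma graded_completion v s :
    unimodular v -> map_mx (specialize 0) v = @e1 R n ->
    phi s = s%:P -> s <> 0 -> (forall r, phi r = r%:P -> 1 + s * r <> 0) ->
  exists A : 'M[R]_n.+1, [/\ A \in unitmx, map_mx (specialize 0) A = 1%:M & v *m A = @e1 R n].
Proof.
move=> uv v0 hs s0 snu; have [r [hr red_t]] := reduces_to_scalar_degree0 uv hs s0.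
have t0 := snu r hr; set t := 1 + s * r in t0 red_t.
have ht : phi t = t%:P by rewrite /t rmorphD rmorphM /= hs hr rmorph1 polyCD polyCM.
have {}red_t := red_t (introN eqP t0).
have [A uA vA] : exists2 A : 'M[R]_n.+1, A \in unitmx & v *m A = @e1 R n.
  have [r' [hr' red_t']] := reduces_to_scalar_degree0 uv ht t0.
  (* If [t' = 0], then [t r' = -1], so [t] is a unit and is comaximal with itself. *)
  have [t'0|t'0] := eqVneq (1 + t * r') 0.
    apply: (graded_patching (z := r' ^+ 2) (z' := 0) red_t red_t ht ht _ v0).
    rewrite mulr0 addr0 -exprMn (_ : t * r' = -1) ?sqrrN ?expr1n //.
    by apply/eqP; rewrite -addr_eq0 addrC t'0.
  have ht' : phi (1 + t * r') = (1 + t * r')%:P.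
    by rewrite rmorphD rmorphM /= ht hr' rmorph1 [RHS]polyCD polyCM.
  (* With [p = 1 + t r'] and [q = - t r'], so that [p + q = 1], the coefficients come from [1 = (p +
     q)^3 = q^2 (q + 3 p) + p^2 (p + 3 q)]. *)
  apply: (graded_patching (z := r' ^+ 2 * (- t * r' + 3 * (1 + t * r')))
    (z' := (1 + t * r') - 3 * t * r') red_t (red_t' t'0) ht ht' _ v0).
  by ring.
have specK x : specialize 0 (specialize 0 x) = specialize 0 x.
  by rewrite !specialize0 phiP.2 coefZ coefXn mulr1.
(* Multiplying by the inverse of the degree-zero part of [A] makes that part the identity; this part
   fixes [e_1], as specializing [v A = e_1] shows. *)
pose B := map_mx (specialize 0) (invmx A).
have AB : map_mx (specialize 0) A *m B = 1%:M by rewrite -map_mxM mulmxV // map_mx1.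
exists (A *m B); split.
- by rewrite unitmx_mul uA; case/mulmx1_unit: AB.
- rewrite map_mxM -[map_mx _ B](_ : B = _) //.
  by apply/matrixP => i j; rewrite !mxE specK.
- have e1A : @e1 R n = @e1 R n *m map_mx (specialize 0) A.
    by rewrite -[in RHS]v0 -map_mxM vA map_e1.
  by rewrite mulmxA vA e1A -mulmxA AB mulmx1.
Qed.
End GradedCompletion.

(** * Completion of rows relative to [R_+], and the homotopy group acting on all rows *)

Theorem mainTheorem7 (R : idomainType) (Rg : nat -> R -> Prop) (d : nat) :
  @noetherian R ->
  graded Rg ->
  krull_dim (@whole R) d ->
  (2 <= d)%N ->
  (exists c, prime_chain (Rg 0%N) 1 c) ->
  (forall v : 'rV[R]_d.+1, Um_rel (Rplus Rg) v ->
     exists a : 'M[R]_d.+1, GL_rel (Rplus Rg) a /\ v *m a = @e1 R d) /\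
  (forall v : 'rV[R]_d.+1,
     unimodular v <-> exists a : 'M[R]_d.+1, Hgrp a /\ v = @e1 R d *m a).
Proof.
move=> noethR gradR [_ dim_le] _ [c [c_pr c_lt]].
have [phi [phiP RgE]] := graded_morphism_exists gradR.
have dimR (P : R -> Prop) : ~ height_ge d.+1 P.
  by move=> /height_ge_chain [p chain_p _]; apply: dim_le; exists p.
have Rg0E x : Rg 0%N x <-> phi x = x%:P by rewrite RgE expr0 alg_polyC.
have RplusE x : Rplus Rg x <-> specialize phi 0 x = 0.
  rewrite specialize0; split=> [[m [f [Rf ->]]]|x0].
    rewrite rmorph_sum coef_sum big_nat big1 // => i /andP[i_gt0 _].
    by rewrite (RgE i _).1 // coefZ coefXn eq_sym gtn_eqF // mulr0.
  exists (size (phi x)), (fun i => (phi x)`_i); split=> [i|]; first exact/RgE/phiP.2.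
  rewrite {1}(sum_comp phiP x); case: (size (phi x)) => [|m].
    by rewrite big_ord0 big_geq.
  by rewrite big_ord_recl x0 add0r big_add1 /= big_mkord.
have idRplus : sub_ideal (@whole R) (Rplus Rg).
  split=> //.
  - by apply/RplusE; rewrite rmorph0.
  - by move=> x y /RplusE x0 /RplusE y0; apply/RplusE; rewrite specialize0 rmorphB coefB -!specialize0 x0 y0 subrr.
  - by move=> a x _ /RplusE x0; apply/RplusE; rewrite specialize0 rmorphM coef0M -!specialize0 x0 mulr0.
(* An element of the upper prime of [R_0] outside the lower one is nonzero, and [1 + s r = 0] would
   put 1 in the upper prime. *)
have [s [hs s0 snu]] : exists s, [/\ phi s = s%:P, s <> 0 &
    forall r, phi r = r%:P -> 1 + s * r <> 0].
  have [_ [s [c1s nc0s]]] := c_lt 0%N isT.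
  have [[_ c00 _ _] _ _] := c_pr 0%N isT.
  have [[c1R _ _ c1M] nc11 _] := c_pr 1%N isT.
  exists s; split; [exact/Rg0E/c1R|by move=> s0; apply: nc0s; rewrite s0|].
  move=> r hr sr; apply: nc11.
  have -> : 1 = - r * s by rewrite mulNr [r * s]mulrC; apply/eqP; rewrite -addr_eq0 sr.
  by apply: c1M => //; apply/Rg0E; rewrite rmorphN /= hr polyCN.
have relE m p (A B : 'M[R]_(m, p)) :
    (forall i j, Rplus Rg (A i j - B i j)) ->
    map_mx (specialize phi 0) A = map_mx (specialize phi 0) B.
  move=> AB; apply/matrixP => i j; rewrite !mxE; apply/subr0_eq.
  by rewrite -rmorphB; apply/RplusE.
have completion v : Um_rel (Rplus Rg) v ->
    exists A : 'M[R]_d.+1, [/\ A \in unitmx, map_mx (specialize phi 0) A = 1%:M &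
                               v *m A = @e1 R d].
  move=> [uv ve]; apply: graded_completion hs s0 snu => //.
  rewrite -[RHS](map_e1 d (specialize phi 0)); apply: relE => i j; rewrite ord1; exact: ve.
split=> [v /completion [A [uA A0 vA]]|v].
  exists A; split=> //; split=> // i j; apply/RplusE.
  rewrite specialize0 rmorphB coefB -!specialize0.
  have /matrixP/(_ i j) := A0; rewrite [LHS]mxE => ->.
  by rewrite -[in X in X - _](map_mx1 (specialize phi 0)) [X in X - _]mxE subrr.
split=> [uv|[a [/Hgrp_unitmx ua ->]]]; last first.
  exists (invmx a *m (@e1 R d)^T); rewrite mulmxA mulmxK //.
  by rewrite /e1 trmx_delta mul_delta_mx; apply/matrixP => i j; rewrite !ord1 !mxE eqxx.
have [_ [_ [_ [_ [_ [_ [i [x [i_gt0 [Rx x0]]]]]]]]]] := gradR.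
have Ix : Rplus Rg x.
  by apply/RplusE; rewrite specialize0 (RgE i x).1 // coefZ coefXn eq_sym gtn_eqF // mulr0.
(* A nonzero element of [R_+] allows the stable range modulo [R_+]. With [t = 1] the reducing matrix
   lies in [Hgrp] and makes [v] congruent to [e_1] modulo [R_+]. *)
have [y y1] := stable_range_quotient noethR dimR idRplus Ix x0 uv.
have [M [M' [_ _ vM HM]]] := row_reduction idRplus y1.
have {}HM : Hgrp M by exact: HM.
have [|A [uA A0 vMA]] := completion (v *m M).
  split; last by move=> j; have := vM j; rewrite scale1r !mxE.
  case: uv => w vw; exists (invmx M *m w).
  by rewrite mulmxA mulmxK // Hgrp_unitmx.
(* The grading itself gives the homotopy: [phi] applied to [A] has value [A] at 1 and, at 0, the
   degree-zero part of [A], which is the identity. *)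
have HA : Hgrp A.
  have [uphiA _] := map_mx_unitmx phi uA.
  apply/HgrpP; exists (map_mx phi A); split=> //; first by rewrite -map_mx_comp.
  by rewrite -map_mx_comp; apply/matrixP => k l; rewrite mxE; apply: phiP.1.
exists (invmx (M *m A)); split; first by apply/Hgrp_inv/Hgrp_mul.
by rewrite -vMA -(mulmxA v) mulmxK // unitmx_mul !Hgrp_unitmx.
Qed.
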